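(* Let $G_1$ and $G_2$ be isoclinic multiplicative Lie algebras. Then $\tilde B_0(G_1)\cong\tilde B_0(G_2)$.
   Context: Notation: ${}^xy=xyx^{-1}$, $[x,y]=xyx^{-1}y^{-1}$. A multiplicative Lie algebra is a triple $(G,\cdot,\star)$ where $(G,\cdot)$ is a (not necessarily abelian) group and $\star$ is a binary operation on $G$ with, for all $x,y,z\in G$: (1) $x\star x=1$; (2) $x\star(yz)=(x\star y)\,{}^y(x\star z)$; (3) $(xy)\star z={}^x(y\star z)\,(x\star z)$; (4) $((x\star y)\star{}^yz)((y\star z)\star{}^zx)((z\star x)\star{}^xy)=1$; (5) ${}^z(x\star y)={}^zx\star{}^zy$. Homomorphisms preserve $\cdot$ and $\star$. $(G\star G)[G,G]$ is the product of the subgroup generated by all $x\star y$ and the commutator subgroup. Isoclinism. Let ${}^M[G,G]=(G\star G)[G,G]$ and $\mathcal Z(G)=\{x\in G: [x,g]=1 \text{ and } x\star g=1 \text{ for all } g\in G\}$. Multiplicative Lie algebras $G$ and $H$ are isoclinic if there exist multiplicative Lie algebra isomorphisms $\lambda:G/\mathcal Z(G)\to H/\mathcal Z(H)$ and $\mu:{}^M[G,G]\to{}^M[H,H]$ such that whenever $\lambda(a\mathcal Z(G))=a'\mathcal Z(H)$ and $\lambda(b\mathcal Z(G))=b'\mathcal Z(H)$ one has $\mu([a,b])=[a',b']$ and $\mu(a\star b)=a'\star b'$. Lie exterior square. $G\wedge^LG$ is the multiplicative Lie algebra (with product $\tilde\star$) generated by formal symbols $x\wedge y$ and $[x,y]_0$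 ($x,y\in G$) subject to, for all $x,y,z,u,v\in G$: (1) $1\wedge x=x\wedge1=x\wedge x=1=[1,x]_0=[x,1]_0=[x,x]_0$; (2) $(x\wedge y)(y\wedge x)=1=[x,y]_0[y,x]_0$; (3) $x\wedge yz=(x\wedge y)({}^yx\wedge{}^yz)$ and $[x,yz]_0=[x,y]_0[{}^yx,{}^yz]_0$; (4) $xy\wedge z=({}^xy\wedge{}^xz)(x\wedge z)$ and $[xy,z]_0=[{}^xy,{}^xz]_0[x,z]_0$; (5) $[x\wedge y,u\wedge v]=[[x,y]_0,u\wedge v]=[x,y]_0\tilde\star(u\wedge v)=[x,y]_0\tilde\star[u,v]_0$; (6) $(x\wedge y)({}^zy\wedge{}^zx)=({}^{xy}x^{-1}\wedge{}^xz)(x\wedge z)$; (7) $[x,y]_0[{}^zy,{}^zx]_0=[{}^{xy}x^{-1},{}^xz]_0[x,z]_0$; (8) $[[x,y]_0,[u,v]_0]=[[x,y],[u,v]]_0$; (9) $(x\wedge y)\tilde\star(u\wedge v)=(x\star y)\wedge(u\star v)$. There is a unique homomorphism $\chi:G\wedge^LG\to G$ with $\chi(x\wedge y)=x\star y$, $\chi([x,y]_0)=[x,y]$; its image is $(G\star G)[G,G]$. The Schur multiplier $\tilde M(G)$ is identified with $\ker\chi$. Put $\tilde M_0(G)=\langle x\wedge y,\ [x,y]_0 \mid x,y\in G,\ x\star y=1=[x,y]\rangle\subseteq\ker\chi$ and $\tilde B_0(G)=\tilde M(G)/\tilde M_0(G)$. *)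

(* Defs.v *)
From HB Require Import structures.
#[warnings="-notation-overridden"]
From mathcomp Require Import all_boot.
From mathcomp Require Import boolp.

Set Implicit Arguments.
Unset Strict Implicit.
Unset Printing Implicit Defensive.
#[local] Set Warnings "-redundant-canonical-projection,-projection-no-head-constant".

Import Algebra.
Local Open Scope group_scope.
Local Open Scope quotient_scope.

(* Left conjugation and the matching commutator.  MathComp's own [x ^ y] and
   [~ x, y] are y^-1 * x * y and x^-1 * y^-1 * x * y, hence not these. *)
Definition lconjg (G : groupType) (x y : G) : G := x * y * x^-1.
Definition lcommg (G : groupType) (x y : G) : G := x * y * x^-1 * y^-1.

Notation "x ^> y" := (lconjg x y)
  (at level 35, right associativity) : group_scope.
Notation "[! x , y ]" := (lcommg x y)
  (at level 0, x, y at level 99, format "[! x ,  y ]") : group_scope.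
Reserved Notation "x ⋆ y" (at level 40, left associativity).

(* [groupType] covers infinite groups.  It carries a choice operator, which
   the classical axioms of [boolp] provide on every type. *)
HB.mixin Record Group_isMulLie G of Group G := {
  star : G -> G -> G;
  starxx : forall x, star x x = 1;
  starMr : forall x y z, star x (y * z) = star x y * lconjg y (star x z);
  starMl : forall x y z, star (x * y) z = lconjg x (star y z) * star x z;
  star_jacobi : forall x y z,
    star (star x y) (lconjg y z) * star (star y z) (lconjg z x)
      * star (star z x) (lconjg x y) = 1;
  starJ : forall x y z,
    lconjg z (star x y) = star (lconjg z x) (lconjg z y)
}.

#[short(type="mulLieType")]
HB.structure Definition MulLie := {G of Group_isMulLie G & Group G}.

Notation "x ⋆ y" := (star x y) : group_scope.

Definition mul_lie_morphism (G H : mulLieType) (f : G -> H) : Prop :=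
  {morph f : x y / x * y} /\ {morph f : x y / x ⋆ y}.

Definition mul_lie_iso (G H : mulLieType) (f : G -> H) : Prop :=
  mul_lie_morphism f /\ bijective f.

Definition isomorphic (G H : mulLieType) : Prop :=
  exists f : G -> H, mul_lie_iso f.

Definition gsimp (G : groupType) :=
  (@invgM G, @invgK G, @invg1 G, @mulgA G, @mulgK G, @mulgVK G, @mulgV G,
   @mulVg G, @mul1g G, @mulg1 G).

Section GroupIdentities.
Variable G : groupType.
Implicit Types x y z a b : G.

Lemma lconjgM z x y : z ^> (x * y) = (z ^> x) * (z ^> y).
Proof. by rewrite /lconjg !gsimp. Qed.

Lemma lconjMg x y z : (x * y) ^> z = x ^> y ^> z.
Proof. by rewrite /lconjg !gsimp. Qed.

Lemma lconjgV z x : z ^> x^-1 = (z ^> x)^-1.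
Proof. by rewrite /lconjg !gsimp. Qed.

Lemma lconjg1 z : z ^> 1 = 1 :> G.
Proof. by rewrite /lconjg !gsimp. Qed.

Lemma lconj1g z : 1 ^> z = z.
Proof. by rewrite /lconjg !gsimp. Qed.

Lemma lconjgK z : cancel (lconjg z^-1) (lconjg z).
Proof. by move=> x; rewrite /lconjg !gsimp. Qed.

Lemma lconjVgK z : cancel (lconjg z) (lconjg z^-1).
Proof. by move=> x; rewrite /lconjg !gsimp. Qed.

Lemma lconjg_lcommg z x y : z ^> [! x, y] = [! z ^> x, z ^> y].
Proof. by rewrite /lconjg /lcommg !gsimp. Qed.

Lemma lcommgE x y : [! x, y] = (x ^> y) * y^-1.
Proof. by []. Qed.

Lemma lcommgV x y : [! x, y]^-1 = [! y, x].
Proof. by rewrite /lcommg !gsimp. Qed.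

Lemma lcommg1P x y : [! x, y] = 1 <-> x * y = y * x.
Proof.
split=> [h|h]; last by rewrite /lcommg h !gsimp.
by apply: (mulIg (x^-1)); apply: (mulIg (y^-1)); rewrite -/(lcommg x y) h !gsimp.
Qed.

Lemma lcommg_eq_lconjg x y : [! x, y] = 1 <-> x ^> y = y.
Proof.
rewrite lcommgE; split=> [h|->]; last by rewrite mulgV.
by rewrite -[LHS]mulg1 -(mulVg y) mulgA h mul1g.
Qed.

End GroupIdentities.

Section MulLieIdentities.
Variable G : mulLieType.
Implicit Types x y z u v : G.

Lemma starx1 x : x ⋆ 1 = 1.
Proof.
have := starMr x 1 1; rewrite mulg1 lconj1g => h.
by apply: (mulgI (x ⋆ 1)); rewrite -h mulg1.
Qed.

Lemma star1x x : 1 ⋆ x = 1.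
Proof.
have := starMl 1 1 x; rewrite mulg1 lconj1g => h.
by apply: (mulgI (1 ⋆ x)); rewrite -h mulg1.
Qed.

Lemma star_antisym x y : (x ⋆ y) * (y ⋆ x) = 1.
Proof.
have := starxx (y * x).
rewrite starMl !starMr !starxx lconjg1 mul1g mulg1 -lconjgM.
by move/(congr1 (lconjg y^-1)); rewrite lconjVgK lconjg1.
Qed.

Lemma starV x y : (x ⋆ y)^-1 = y ⋆ x.
Proof. by apply: (mulgI (x ⋆ y)); rewrite mulgV star_antisym. Qed.

Lemma star_swap x y u v :
  ((x * y) ^> (u ⋆ v)) * (x ⋆ y) = (x ⋆ y) * ((y * x) ^> (u ⋆ v)).
Proof.
have := starMr (x * u) y v; rewrite starMl !starMr !starMl.
move/(congr1 (fun w => (x ^> (u ⋆ y))^-1 * w * (y ^> (x ⋆ v))^-1)).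
by rewrite /lconjg !gsimp.
Qed.

Lemma star_act x y u v : (x ⋆ y) ^> (u ⋆ v) = [! x, y] ^> (u ⋆ v).
Proof.
have := star_swap x y ((y * x)^-1 ^> u) ((y * x)^-1 ^> v).
rewrite -starJ lconjgK => h.
rewrite {1}/lconjg -h -lconjMg [X in X ^> _ * _](_ : _ = [! x, y]).
  by rewrite /lconjg !gsimp.
by rewrite /lcommg !gsimp.
Qed.

Lemma star_lcommg x y z : [! x, y] ⋆ z = [! x ⋆ y, z].
Proof.
have e1 : (x * y) ⋆ (z * y) = (x ^> (y ⋆ z)) * (x ⋆ z) * (z ^> (x ⋆ y)).
  by rewrite starMl !starMr starxx lconjg1 mulg1 mulgA.
have e2 : (x * y) ⋆ (z * y) = (x ⋆ y) * (y ^> (x ⋆ z)) * (y ⋆ z).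
  have exp a b : (y * a) ⋆ (y * b) =
      ((y ^> a) ⋆ y) * (y ^> ((y ^> a) ⋆ (y ^> b))) * (y ⋆ (y ^> b)).
    have yy : y ^> y = y by rewrite /lconjg !gsimp.
    rewrite starMl (starMr a) (starMr y) starxx mul1g.
    by rewrite (lconjgM y (a ⋆ y)) (starJ a y) (starJ a b) (starJ y b) yy.
  have := exp (y^-1 ^> x) (y^-1 ^> z); rewrite !lconjgK => <-.
  by congr (_ ⋆ _); rewrite /lconjg !gsimp.
have e3 : (x * y) ⋆ z =
    ([! x, y] ^> ((y ^> (x ⋆ z)) * (y ⋆ z))) * ([! x, y] ⋆ z).
  rewrite -starMl -starMl; congr (_ ⋆ _).
  by rewrite /lcommg !gsimp.
have e4 : [! x, y] ^> ((y ^> (x ⋆ z)) * (y ⋆ z)) =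
          (x ⋆ y) ^> ((y ^> (x ⋆ z)) * (y ⋆ z)).
  by rewrite (starJ x z y) !(lconjgM, star_act).
move: e3; rewrite e4 starMl => e3.
apply: (mulgI ((x ⋆ y) ^> (y ^> (x ⋆ z) * (y ⋆ z)))); rewrite -e3.
apply: (mulIg (z ^> (x ⋆ y))); rewrite -e1 e2.
by rewrite /lcommg /lconjg !gsimp.
Qed.

End MulLieIdentities.

Record mul_lie_sub (G : mulLieType) := MulLieSub {
  sub_pred :> G -> Prop;
  sub1 : sub_pred 1;
  subM : forall x y, sub_pred x -> sub_pred y -> sub_pred (x * y);
  subV : forall x, sub_pred x -> sub_pred x^-1;
  subS : forall x y, sub_pred x -> sub_pred y -> sub_pred (x ⋆ y)
}.

Section SubAlgebra.
Variables (G : mulLieType) (S : mul_lie_sub G).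

Record sub_type := ToSub { sub_val : G; sub_valb : `[< S sub_val >] }.
HB.instance Definition _ := [isSub for sub_val].
HB.instance Definition _ := [Choice of sub_type by <:].

Lemma sub_group_closed : group_closed (fun x : G => `[< S x >]).
Proof.
split; first by apply/asboolP; exact: sub1.
move=> x y /asboolP Sx /asboolP Sy; apply/asboolP.
by apply: subM => //; apply: subV.
Qed.

HB.instance Definition _ :=
  SubChoice_isSubGroup.Build G (fun x : G => `[< S x >]) sub_type
    sub_group_closed.

Definition to_sub (x : G) (Sx : S x) : sub_type := ToSub (asboolT Sx).

Lemma sub_valP (u : sub_type) : S (sub_val u).
Proof. exact/asboolP/(sub_valb u). Qed.

Lemma sub_val_inj : injective sub_val. Proof. exact: val_inj. Qed.

Definition sub_star (u v : sub_type) : sub_type :=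
  to_sub (subS (sub_valP u) (sub_valP v)).

Lemma sub_val1 : sub_val 1 = 1. Proof. by []. Qed.
Lemma sub_valM (u v : sub_type) : sub_val (u * v) = sub_val u * sub_val v.
Proof. by []. Qed.
Lemma sub_valV (u : sub_type) : sub_val u^-1 = (sub_val u)^-1.
Proof. by []. Qed.
Lemma sub_valJ (u v : sub_type) : sub_val (u ^> v) = sub_val u ^> sub_val v.
Proof. by rewrite /lconjg !sub_valM sub_valV. Qed.

Lemma sub_starE u v : sub_val (sub_star u v) = sub_val u ⋆ sub_val v.
Proof. by []. Qed.

Fact sub_starxx x : sub_star x x = 1.
Proof. by apply: sub_val_inj; rewrite sub_val1 sub_starE starxx. Qed.
Fact sub_starMr x y z :
  sub_star x (y * z) = sub_star x y * (y ^> sub_star x z).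
Proof.
by apply: sub_val_inj; rewrite sub_valM sub_valJ !sub_starE sub_valM starMr.
Qed.
Fact sub_starMl x y z :
  sub_star (x * y) z = (x ^> sub_star y z) * sub_star x z.
Proof.
by apply: sub_val_inj; rewrite sub_valM sub_valJ !sub_starE sub_valM starMl.
Qed.
Fact sub_star_jacobi x y z :
  sub_star (sub_star x y) (y ^> z) * sub_star (sub_star y z) (z ^> x)
    * sub_star (sub_star z x) (x ^> y) = 1.
Proof.
apply: sub_val_inj; rewrite sub_val1 !sub_valM !sub_starE !sub_valJ.
exact: star_jacobi.
Qed.
Fact sub_starJ x y z :
  z ^> sub_star x y = sub_star (z ^> x) (z ^> y).
Proof. by apply: sub_val_inj; rewrite sub_valJ !sub_starE !sub_valJ starJ. Qed.

HB.instance Definition _ := Group_isMulLie.Build sub_type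
  sub_starxx sub_starMr sub_starMl sub_star_jacobi sub_starJ.

End SubAlgebra.

Record mul_lie_ideal (G : mulLieType) := MulLieIdeal {
  ideal_pred :> G -> Prop;
  ideal1 : ideal_pred 1;
  idealM : forall x y, ideal_pred x -> ideal_pred y -> ideal_pred (x * y);
  idealV : forall x, ideal_pred x -> ideal_pred x^-1;
  idealJ : forall g x, ideal_pred x -> ideal_pred (g ^> x);
  idealSr : forall g x, ideal_pred x -> ideal_pred (g ⋆ x);
  idealSl : forall g x, ideal_pred x -> ideal_pred (x ⋆ g)
}.

Section Quotient.
Variables (G : mulLieType) (I : mul_lie_ideal G).
Implicit Types x y z : G.

Definition quo_rel x y : bool := `[< I (x * y^-1) >].

Fact quo_rel_refl : reflexive quo_rel.
Proof. by move=> x; apply/asboolP; rewrite mulgV; apply: ideal1. Qed.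
Fact quo_rel_sym : symmetric quo_rel.
Proof.
by move=> x y; apply/asboolP/asboolP => /idealV; rewrite invgM invgK.
Qed.
Fact quo_rel_trans : transitive quo_rel.
Proof.
move=> y x z /asboolP h1 /asboolP h2; apply/asboolP.
by have := idealM h1 h2; rewrite !gsimp.
Qed.

Canonical quo_equiv := EquivRel quo_rel quo_rel_refl quo_rel_sym quo_rel_trans.

Definition quo_type : Type := {eq_quot quo_equiv}.
HB.instance Definition _ := Choice.on quo_type.
HB.instance Definition _ := Quotient.on quo_type.

Definition to_quo : G -> quo_type := \pi_quo_type.

Lemma to_quoP x y : to_quo x = to_quo y <-> I (x * y^-1).
Proof.
split=> [/eqP|h].
  by rewrite eqmodE => /asboolP.
by apply/eqP; rewrite eqmodE; apply/asboolP.
Qed.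

Lemma quoW (P : quo_type -> Prop) : (forall x, P (to_quo x)) -> forall q, P q.
Proof. by move=> h q; rewrite -[q]reprK; apply: h. Qed.

Definition quo_one : quo_type := to_quo 1.
Definition quo_mul (p q : quo_type) : quo_type := to_quo (repr p * repr q).
Definition quo_inv (p : quo_type) : quo_type := to_quo (repr p)^-1.
Definition quo_star (p q : quo_type) : quo_type := to_quo (repr p ⋆ repr q).

Lemma quo_repr x : I (repr (to_quo x) * x^-1).
Proof. by apply/to_quoP; rewrite /to_quo reprK. Qed.

Lemma quo_mulE x y : quo_mul (to_quo x) (to_quo y) = to_quo (x * y).
Proof.
apply/to_quoP; set x' := repr _; set y' := repr _.
have -> : x' * y' * (x * y)^-1 = (x' ^> (y' * y^-1)) * (x' * x^-1).
  by rewrite /lconjg !gsimp.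
by apply: idealM; [apply: idealJ|]; apply: quo_repr.
Qed.

Lemma quo_invE x : quo_inv (to_quo x) = to_quo x^-1.
Proof.
apply/to_quoP; set x' := repr _.
have -> : x'^-1 * x^-1^-1 = x^-1 ^> (x' * x^-1)^-1 by rewrite /lconjg !gsimp.
by apply: idealJ; apply: idealV; apply: quo_repr.
Qed.

Lemma ideal_starr g a y : I a -> I ((g ⋆ (a * y)) * (g ⋆ y)^-1).
Proof.
move=> Ia; rewrite starMr.
have -> : (g ⋆ a) * (a ^> (g ⋆ y)) * (g ⋆ y)^-1 =
    (g ⋆ a) * (a * ((g ⋆ y) ^> a^-1)) by rewrite /lconjg !gsimp.
apply: idealM; first exact: idealSr.
by apply: idealM => //; apply: idealJ; apply: idealV.
Qed.

Lemma ideal_starl g a x : I a -> I (((a * x) ⋆ g) * (x ⋆ g)^-1).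
Proof.
move=> Ia; rewrite starMl.
have -> : (a ^> (x ⋆ g)) * (a ⋆ g) * (x ⋆ g)^-1 =
    a * ((x ⋆ g) ^> (a^-1 * (a ⋆ g))) by rewrite /lconjg !gsimp.
apply: idealM => //; apply: idealJ.
by apply: idealM; [apply: idealV|apply: idealSl].
Qed.

Lemma quo_starE x y : quo_star (to_quo x) (to_quo y) = to_quo (x ⋆ y).
Proof.
rewrite /quo_star; set x' := repr _; set y' := repr _.
transitivity (to_quo (x' ⋆ y)); apply/to_quoP.
  by rewrite -[y'](mulgVK y); apply/ideal_starr/quo_repr.
by rewrite -[x'](mulgVK x); apply/ideal_starl/quo_repr.
Qed.

Fact quo_mulA : associative quo_mul.
Proof.
elim/quoW=> x; elim/quoW=> y; elim/quoW=> z.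
by rewrite !quo_mulE mulgA.
Qed.
Fact quo_mul1g : left_id quo_one quo_mul.
Proof. by elim/quoW=> x; rewrite quo_mulE mul1g. Qed.
Fact quo_mulg1 : right_id quo_one quo_mul.
Proof. by elim/quoW=> x; rewrite quo_mulE mulg1. Qed.
Fact quo_mulVg : left_inverse quo_one quo_inv quo_mul.
Proof. by elim/quoW=> x; rewrite quo_invE quo_mulE mulVg. Qed.
Fact quo_mulgV : right_inverse quo_one quo_inv quo_mul.
Proof. by elim/quoW=> x; rewrite quo_invE quo_mulE mulgV. Qed.

HB.instance Definition _ := isGroup.Build quo_type
  quo_mulA quo_mul1g quo_mulg1 quo_mulVg quo_mulgV.

Lemma to_quoM x y : to_quo (x * y) = to_quo x * to_quo y.
Proof. by rewrite -quo_mulE. Qed.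
Lemma to_quoV x : to_quo x^-1 = (to_quo x)^-1.
Proof. by rewrite -quo_invE. Qed.
Lemma to_quo1 : to_quo 1 = 1.
Proof. by []. Qed.
Lemma to_quoJ x y : to_quo (x ^> y) = to_quo x ^> to_quo y.
Proof. by rewrite !to_quoM to_quoV. Qed.

Fact quo_starxx p : quo_star p p = 1.
Proof. by elim/quoW: p => x; rewrite quo_starE starxx. Qed.
Fact quo_starMr p q r :
  quo_star p (q * r) = quo_star p q * (q ^> quo_star p r).
Proof.
elim/quoW: p => x; elim/quoW: q => y; elim/quoW: r => z.
by rewrite -to_quoM !quo_starE -to_quoJ -to_quoM starMr.
Qed.
Fact quo_starMl p q r :
  quo_star (p * q) r = (p ^> quo_star q r) * quo_star p r.
Proof.
elim/quoW: p => x; elim/quoW: q => y; elim/quoW: r => z.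
by rewrite -to_quoM !quo_starE -to_quoJ -to_quoM starMl.
Qed.
Fact quo_star_jacobi p q r :
  quo_star (quo_star p q) (q ^> r) * quo_star (quo_star q r) (r ^> p)
    * quo_star (quo_star r p) (p ^> q) = 1.
Proof.
elim/quoW: p => x; elim/quoW: q => y; elim/quoW: r => z.
by rewrite -!to_quoJ !quo_starE -!to_quoM star_jacobi.
Qed.
Fact quo_starJ p q r :
  r ^> quo_star p q = quo_star (r ^> p) (r ^> q).
Proof.
elim/quoW: p => x; elim/quoW: q => y; elim/quoW: r => z.
by rewrite (quo_starE x y) -!to_quoJ quo_starE starJ.
Qed.

HB.instance Definition _ := Group_isMulLie.Build quo_type
  quo_starxx quo_starMr quo_starMl quo_star_jacobi quo_starJ.

Lemma to_quoS x y : to_quo (x ⋆ y) = to_quo x ⋆ to_quo y.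
Proof. by rewrite -quo_starE. Qed.

End Quotient.

Inductive mla_term (X : Type) : Type :=
| TVar of X
| TOne
| TMul of mla_term X & mla_term X
| TInv of mla_term X
| TStar of mla_term X & mla_term X.
Arguments TOne {X}.

Declare Scope mla_term_scope.
Delimit Scope mla_term_scope with T.
Bind Scope mla_term_scope with mla_term.

Definition TConj X (a b : mla_term X) := TMul (TMul a b) (TInv a).
Definition TComm X (a b : mla_term X) :=
  TMul (TMul (TMul a b) (TInv a)) (TInv b).

Notation "1" := TOne : mla_term_scope.
Notation "a * b" := (TMul a b) : mla_term_scope.
Notation "a ^-1" := (TInv a) : mla_term_scope.
Notation "a ⋆ b" := (TStar a b) : mla_term_scope.
Notation "a ^> b" := (TConj a b) : mla_term_scope.
Notation "[! a , b ]" := (TComm a b) : mla_term_scope.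

(* The least congruence on terms containing R and the axioms of
   multiplicative Lie algebras. *)
Inductive pres_eq (X : Type) (R : mla_term X -> mla_term X -> Prop) :
  mla_term X -> mla_term X -> Prop :=
| PRel a b : R a b -> pres_eq R a b
| PRefl a : pres_eq R a a
| PSym a b : pres_eq R a b -> pres_eq R b a
| PTrans a b c : pres_eq R a b -> pres_eq R b c -> pres_eq R a c
| PMul a a' b b' :
    pres_eq R a a' -> pres_eq R b b' -> pres_eq R (a * b)%T (a' * b')%T
| PInv a a' : pres_eq R a a' -> pres_eq R (a^-1)%T (a'^-1)%T
| PStar a a' b b' :
    pres_eq R a a' -> pres_eq R b b' -> pres_eq R (a ⋆ b)%T (a' ⋆ b')%T
| PmulA a b c : pres_eq R (a * (b * c))%T (a * b * c)%T
| Pmul1g a : pres_eq R (1 * a)%T a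
| Pmulg1 a : pres_eq R (a * 1)%T a
| PmulVg a : pres_eq R (a^-1 * a)%T 1%T
| PmulgV a : pres_eq R (a * a^-1)%T 1%T
| Pstarxx a : pres_eq R (a ⋆ a)%T 1%T
| PstarMr a b c : pres_eq R (a ⋆ (b * c))%T ((a ⋆ b) * (b ^> (a ⋆ c)))%T
| PstarMl a b c : pres_eq R ((a * b) ⋆ c)%T ((a ^> (b ⋆ c)) * (a ⋆ c))%T
| Pstar_jacobi a b c :
    pres_eq R (((a ⋆ b) ⋆ (b ^> c)) * ((b ⋆ c) ⋆ (c ^> a))
                 * ((c ⋆ a) ⋆ (a ^> b)))%T 1%T
| PstarJ a b c : pres_eq R (c ^> (a ⋆ b))%T ((c ^> a) ⋆ (c ^> b))%T.

Fixpoint mla_eval (X : Type) (H : mulLieType) (f : X -> H) (t : mla_term X) : H :=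
  match t with
  | TVar x => f x
  | TOne => 1
  | TMul a b => mla_eval f a * mla_eval f b
  | TInv a => (mla_eval f a)^-1
  | TStar a b => mla_eval f a ⋆ mla_eval f b
  end.

Section Presentation.
Variables (X : Type) (R : mla_term X -> mla_term X -> Prop).
Implicit Types a b c : mla_term X.

Definition pres_rel (a b : {classic mla_term X}) : bool := `[< pres_eq R a b >].

Fact pres_rel_refl : reflexive pres_rel.
Proof. by move=> a; apply/asboolP; apply: PRefl. Qed.
Fact pres_rel_sym : symmetric pres_rel.
Proof. by move=> a b; apply/asboolP/asboolP; apply: PSym. Qed.
Fact pres_rel_trans : transitive pres_rel.
Proof.
by move=> b a c /asboolP h1 /asboolP h2; apply/asboolP; apply: PTrans h2.
Qed.

Canonical pres_equiv :=
  EquivRel pres_rel pres_rel_refl pres_rel_sym pres_rel_trans.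

(* The multiplicative Lie algebra generated by X subject to R. *)
Definition presented : Type := {eq_quot pres_equiv}.
HB.instance Definition _ := Choice.on presented.
HB.instance Definition _ := Quotient.on presented.

Definition term_class (a : mla_term X) : presented := \pi_presented a.
Definition term_repr (p : presented) : mla_term X := repr p.

Lemma term_classP a b : term_class a = term_class b <-> pres_eq R a b.
Proof.
split=> [/eqP|h]; first by rewrite eqmodE => /asboolP.
by apply/eqP; rewrite eqmodE; apply/asboolP.
Qed.

Lemma term_reprK p : term_class (term_repr p) = p.
Proof. exact: reprK. Qed.

Lemma presW (P : presented -> Prop) :
  (forall a, P (term_class a)) -> forall p, P p.
Proof. by move=> h p; rewrite -[p]term_reprK. Qed.

Lemma term_repr_class a : pres_eq R (term_repr (term_class a)) a.
Proof. by apply/term_classP; rewrite term_reprK. Qed.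

Definition pres_one : presented := term_class 1%T.
Definition pres_mul (p q : presented) : presented :=
  term_class (term_repr p * term_repr q)%T.
Definition pres_inv (p : presented) : presented :=
  term_class (term_repr p)^-1%T.
Definition pres_star (p q : presented) : presented :=
  term_class (term_repr p ⋆ term_repr q)%T.

Lemma pres_mulE a b :
  pres_mul (term_class a) (term_class b) = term_class (a * b)%T.
Proof. by apply/term_classP; apply: PMul; apply: term_repr_class. Qed.
Lemma pres_invE a : pres_inv (term_class a) = term_class (a^-1)%T.
Proof. by apply/term_classP; apply: PInv; apply: term_repr_class. Qed.
Lemma pres_starE a b :
  pres_star (term_class a) (term_class b) = term_class (a ⋆ b)%T.
Proof. by apply/term_classP; apply: PStar; apply: term_repr_class. Qed.

Fact pres_mulA : associative pres_mul.
Proof.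
elim/presW=> a; elim/presW=> b; elim/presW=> c.
by rewrite !pres_mulE; apply/term_classP; apply: PmulA.
Qed.
Fact pres_mul1g : left_id pres_one pres_mul.
Proof. by elim/presW=> a; rewrite pres_mulE; apply/term_classP/Pmul1g. Qed.
Fact pres_mulg1 : right_id pres_one pres_mul.
Proof. by elim/presW=> a; rewrite pres_mulE; apply/term_classP/Pmulg1. Qed.
Fact pres_mulVg : left_inverse pres_one pres_inv pres_mul.
Proof.
by elim/presW=> a; rewrite pres_invE pres_mulE; apply/term_classP/PmulVg.
Qed.
Fact pres_mulgV : right_inverse pres_one pres_inv pres_mul.
Proof.
by elim/presW=> a; rewrite pres_invE pres_mulE; apply/term_classP/PmulgV.
Qed.

HB.instance Definition _ := isGroup.Build presented
  pres_mulA pres_mul1g pres_mulg1 pres_mulVg pres_mulgV.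

Lemma term_classM a b :
  term_class (a * b)%T = term_class a * term_class b.
Proof. by rewrite -pres_mulE. Qed.
Lemma term_classV a : term_class (a^-1)%T = (term_class a)^-1.
Proof. by rewrite -pres_invE. Qed.
Lemma term_class1 : term_class 1%T = 1.
Proof. by []. Qed.
Lemma term_classJ a b : term_class (a ^> b)%T = term_class a ^> term_class b.
Proof. by rewrite !term_classM term_classV. Qed.
Lemma term_classR a b : term_class [! a, b]%T = [! term_class a, term_class b].
Proof. by rewrite !term_classM !term_classV. Qed.

Fact pres_starxx p : pres_star p p = 1.
Proof. by elim/presW: p => a; rewrite pres_starE; apply/term_classP/Pstarxx. Qed.
Fact pres_starMr p q r :
  pres_star p (q * r) = pres_star p q * (q ^> pres_star p r).
Proof.
elim/presW: p => a; elim/presW: q => b; elim/presW: r => c.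
rewrite -term_classM !pres_starE -term_classJ -term_classM.
exact/term_classP/PstarMr.
Qed.
Fact pres_starMl p q r :
  pres_star (p * q) r = (p ^> pres_star q r) * pres_star p r.
Proof.
elim/presW: p => a; elim/presW: q => b; elim/presW: r => c.
rewrite -term_classM !pres_starE -term_classJ -term_classM.
exact/term_classP/PstarMl.
Qed.
Fact pres_star_jacobi p q r :
  pres_star (pres_star p q) (q ^> r) * pres_star (pres_star q r) (r ^> p)
    * pres_star (pres_star r p) (p ^> q) = 1.
Proof.
elim/presW: p => a; elim/presW: q => b; elim/presW: r => c.
rewrite -!term_classJ !pres_starE -!term_classM.
exact/term_classP/Pstar_jacobi.
Qed.
Fact pres_starJ p q r :
  r ^> pres_star p q = pres_star (r ^> p) (r ^> q).
Proof.
elim/presW: p => a; elim/presW: q => b; elim/presW: r => c.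
rewrite (pres_starE a b) -!term_classJ pres_starE.
exact/term_classP/PstarJ.
Qed.

HB.instance Definition _ := Group_isMulLie.Build presented
  pres_starxx pres_starMr pres_starMl pres_star_jacobi pres_starJ.

Lemma term_classS a b : term_class (a ⋆ b)%T = term_class a ⋆ term_class b.
Proof. by rewrite -pres_starE. Qed.

Definition term_classE :=
  (term_classR, term_classJ, term_classS, term_classM, term_classV,
   term_class1).

Lemma pres_ind (P : presented -> Prop) :
  (forall x, P (term_class (TVar x))) -> P 1 ->
  (forall p q, P p -> P q -> P (p * q)) -> (forall p, P p -> P p^-1) ->
  (forall p q, P p -> P q -> P (p ⋆ q)) -> forall p, P p.
Proof.
move=> hX h1 hM hV hS; elim/presW; elim=> [x||a ha b hb|a ha|a ha b hb] //.
- by rewrite term_classM; apply: hM.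
- by rewrite term_classV; apply: hV.
- by rewrite term_classS; apply: hS.
Qed.

Section Lift.
Variables (H : mulLieType) (f : X -> H).

Definition pres_lift (p : presented) : H := mla_eval f (term_repr p).

Hypothesis fR : forall a b, R a b -> mla_eval f a = mla_eval f b.

Lemma mla_eval_pres_eq a b : pres_eq R a b -> mla_eval f a = mla_eval f b.
Proof.
elim=> //=.
- by move=> ? ? ? _ -> _ ->.
- by move=> ? ? ? ? _ -> _ ->.
- by move=> ? ? _ ->.
- by move=> ? ? ? ? _ -> _ ->.
- by move=> ? ? ?; rewrite mulgA.
- by move=> ?; rewrite mul1g.
- by move=> ?; rewrite mulg1.
- by move=> ?; rewrite mulVg.
- by move=> ?; rewrite mulgV.
- by move=> ?; rewrite starxx.
- by move=> ? ? ?; rewrite starMr.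
- by move=> ? ? ?; rewrite starMl.
- by move=> ? ? ?; apply: star_jacobi.
- by move=> ? ? ?; apply: starJ.
Qed.

Lemma pres_liftE a : pres_lift (term_class a) = mla_eval f a.
Proof. exact/mla_eval_pres_eq/term_repr_class. Qed.

Lemma pres_lift_morphism : mul_lie_morphism pres_lift.
Proof.
split; elim/presW=> a; elim/presW=> b.
  by rewrite -term_classM !pres_liftE.
by rewrite -term_classS !pres_liftE.
Qed.

End Lift.
End Presentation.

Lemma mul_lie_morphism1 (G H : mulLieType) (f : G -> H) :
  mul_lie_morphism f -> f 1 = 1.
Proof. by case=> fM _; apply: (mulgI (f 1)); rewrite -fM !mulg1. Qed.

Lemma mul_lie_morphismV (G H : mulLieType) (f : G -> H) (x : G) :
  mul_lie_morphism f -> f x^-1 = (f x)^-1.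
Proof.
move=> hf; have [fM _] := hf; apply: (mulgI (f x)).
by rewrite -fM !mulgV; apply: mul_lie_morphism1.
Qed.

Section Kernel.
Variables (G H : mulLieType) (f : G -> H).
Hypothesis hf : mul_lie_morphism f.

Fact kernel1 : f 1 = 1. Proof. exact: mul_lie_morphism1. Qed.
Fact kernelM x y : f x = 1 -> f y = 1 -> f (x * y) = 1.
Proof. by rewrite hf.1 => -> ->; rewrite mulg1. Qed.
Fact kernelV x : f x = 1 -> f x^-1 = 1.
Proof. by rewrite mul_lie_morphismV // => ->; rewrite invg1. Qed.
Fact kernelS x y : f x = 1 -> f y = 1 -> f (x ⋆ y) = 1.
Proof. by rewrite hf.2 => -> ->; rewrite starxx. Qed.

Definition kernel : mul_lie_sub G := MulLieSub kernel1 kernelM kernelV kernelS.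
End Kernel.

Inductive gen_subgroup (G : groupType) (A : G -> Prop) : G -> Prop :=
| GenMem x : A x -> gen_subgroup A x
| Gen1 : gen_subgroup A 1
| GenM x y : gen_subgroup A x -> gen_subgroup A y -> gen_subgroup A (x * y)
| GenV x : gen_subgroup A x -> gen_subgroup A x^-1.

Section Center.
Variable G : mulLieType.
Implicit Types x y g : G.

Definition lie_center x : Prop := forall g, [! x, g] = 1 /\ x ⋆ g = 1.

Lemma lie_centerC x g : lie_center x -> x * g = g * x.
Proof. by move=> /(_ g)[/lcommg1P]. Qed.

Lemma lie_centerJ x g : lie_center x -> g ^> x = x.
Proof. by move=> /lie_centerC h; rewrite /lconjg -h !gsimp. Qed.

Fact lie_center1 : lie_center 1.
Proof. by move=> g; rewrite star1x /lcommg !gsimp. Qed.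
Fact lie_centerM x y : lie_center x -> lie_center y -> lie_center (x * y).
Proof.
move=> hx hy g; split.
  apply/lcommg1P.
  by rewrite -mulgA (lie_centerC g hy) mulgA (lie_centerC g hx) -mulgA.
by rewrite starMl (hx g).2 (hy g).2 lconjg1 mulg1.
Qed.
Fact lie_centerV x : lie_center x -> lie_center x^-1.
Proof.
move=> hx g; split.
  apply/lcommg1P; apply: (mulgI x); apply: (mulIg x).
  by rewrite !gsimp (lie_centerC _ hx).
have := starMl x^-1 x g.
by rewrite mulVg star1x (hx g).2 lconjg1 mul1g => <-.
Qed.
Fact lie_center_conj g x : lie_center x -> lie_center (g ^> x).
Proof. by move=> hx; rewrite lie_centerJ. Qed.
Fact lie_center_starr g x : lie_center x -> lie_center (g ⋆ x).
Proof. by move=> hx; rewrite -starV (hx g).2 invg1; apply: lie_center1. Qed.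
Fact lie_center_starl g x : lie_center x -> lie_center (x ⋆ g).
Proof. by move=> hx; rewrite (hx g).2; apply: lie_center1. Qed.

Definition center_ideal : mul_lie_ideal G :=
  MulLieIdeal lie_center1 lie_centerM lie_centerV
    lie_center_conj lie_center_starr lie_center_starl.

End Center.

Section Derived.
Variable G : mulLieType.
Implicit Types x y g : G.

Definition star_subgroup : G -> Prop :=
  gen_subgroup (fun x => exists a b, x = a ⋆ b).
Definition comm_subgroup : G -> Prop :=
  gen_subgroup (fun x => exists a b, x = [! a, b]).
Definition derived_pred x : Prop :=
  exists s c, [/\ star_subgroup s, comm_subgroup c & x = s * c].

Lemma comm_subgroup_conj g x : comm_subgroup x -> comm_subgroup (g ^> x).
Proof.
elim=> [_ [a [b ->]]||y z _ hy _ hz|y _ hy].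
- by rewrite lconjg_lcommg; apply: GenMem; exists (g ^> a), (g ^> b).
- by rewrite lconjg1; apply: Gen1.
- by rewrite lconjgM; apply: GenM.
- by rewrite lconjgV; apply: GenV.
Qed.

Lemma derived_star x y : derived_pred (x ⋆ y).
Proof.
exists (x ⋆ y), 1; split; [|exact: Gen1|by rewrite mulg1].
by apply: GenMem; exists x, y.
Qed.
Lemma derived_comm x y : derived_pred [! x, y].
Proof.
exists 1, [! x, y]; split; [exact: Gen1| |by rewrite mul1g].
by apply: GenMem; exists x, y.
Qed.

Fact derived1 : derived_pred 1.
Proof. by rewrite -(starxx 1); apply: derived_star. Qed.
Fact derivedM x y : derived_pred x -> derived_pred y -> derived_pred (x * y).
Proof.
move=> [s [c [hs hc ->]]] [s' [c' [hs' hc' ->]]].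
exists (s * s'), ((s'^-1 ^> c) * c'); split.
- exact: GenM.
- by apply: GenM => //; apply: comm_subgroup_conj.
- by rewrite /lconjg !gsimp.
Qed.
Fact derivedV x : derived_pred x -> derived_pred x^-1.
Proof.
move=> [s [c [hs hc ->]]]; exists s^-1, (s ^> c^-1); split.
- exact: GenV.
- by apply: comm_subgroup_conj; apply: GenV.
- by rewrite /lconjg !gsimp.
Qed.
Fact derivedS x y : derived_pred x -> derived_pred y -> derived_pred (x ⋆ y).
Proof. by move=> _ _; apply: derived_star. Qed.

Definition derived : mul_lie_sub G :=
  MulLieSub derived1 derivedM derivedV derivedS.

End Derived.

Definition center_quo (G : mulLieType) : mulLieType :=
  quo_type (center_ideal G).
Definition center_class (G : mulLieType) (x : G) : center_quo G :=
  to_quo (center_ideal G) x.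

Definition derived_alg (G : mulLieType) : mulLieType := sub_type (derived G).
Definition der_comm (G : mulLieType) (x y : G) : derived_alg G :=
  to_sub (S := derived G) (derived_comm x y).
Definition der_star (G : mulLieType) (x y : G) : derived_alg G :=
  to_sub (S := derived G) (derived_star x y).

Definition isoclinic (G H : mulLieType) : Prop :=
  exists (lam : center_quo G -> center_quo H)
         (mu : derived_alg G -> derived_alg H),
  [/\ mul_lie_iso lam, mul_lie_iso mu &
      forall (a b : G) (a' b' : H),
        lam (center_class a) = center_class a' ->
        lam (center_class b) = center_class b' ->
        mu (der_comm a b) = der_comm a' b' /\
        mu (der_star a b) = der_star a' b'].

Inductive lext_gen (G : Type) : Type :=
| Wedge of G & G
| Bracket of G & G.

Definition wedge (G : Type) (x y : G) : mla_term (lext_gen G) :=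
  TVar (Wedge x y).
Definition brack0 (G : Type) (x y : G) : mla_term (lext_gen G) :=
  TVar (Bracket x y).
Arguments wedge {G} (x y)%_g.
Arguments brack0 {G} (x y)%_g.

Local Notation W := wedge.
Local Notation B := brack0.

Inductive lext_rel (G : mulLieType) :
  mla_term (lext_gen G) -> mla_term (lext_gen G) -> Prop :=
| Lw1x x : lext_rel (W 1 x) 1%T
| Lwx1 x : lext_rel (W x 1) 1%T
| Lwxx x : lext_rel (W x x) 1%T
| Lb1x x : lext_rel (B 1 x) 1%T
| Lbx1 x : lext_rel (B x 1) 1%T
| Lbxx x : lext_rel (B x x) 1%T
| Lw_antisym x y : lext_rel (W x y * W y x)%T 1%T
| Lb_antisym x y : lext_rel (B x y * B y x)%T 1%T
| LwMr x y z :
    lext_rel (W x (y * z)) (W x y * W (y ^> x) (y ^> z))%T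
| LbMr x y z :
    lext_rel (B x (y * z)) (B x y * B (y ^> x) (y ^> z))%T
| LwMl x y z :
    lext_rel (W (x * y) z) (W (x ^> y) (x ^> z) * W x z)%T
| LbMl x y z :
    lext_rel (B (x * y) z) (B (x ^> y) (x ^> z) * B x z)%T
| Lcomm_w_w x y u v :
    lext_rel [! W x y, W u v]%T [! B x y, W u v]%T
| Lcomm_b_w x y u v :
    lext_rel [! B x y, W u v]%T (B x y ⋆ W u v)%T
| Lstar_b_w x y u v :
    lext_rel (B x y ⋆ W u v)%T (B x y ⋆ B u v)%T
| Lw_hall x y z :
    lext_rel (W x y * W (z ^> y) (z ^> x))%T
             (W ((x * y) ^> x^-1) (x ^> z) * W x z)%T
| Lb_hall x y z :
    lext_rel (B x y * B (z ^> y) (z ^> x))%T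
             (B ((x * y) ^> x^-1) (x ^> z) * B x z)%T
| Lcomm_b_b x y u v :
    lext_rel [! B x y, B u v]%T (B [! x, y] [! u, v])
| Lstar_w_w x y u v :
    lext_rel (W x y ⋆ W u v)%T (W (x ⋆ y) (u ⋆ v)).

Section LieExteriorSquare.
Variable G : mulLieType.
Implicit Types x y z u v g : G.

Definition lext : mulLieType := presented (@lext_rel G).

Definition lwedge x y : lext := term_class (@lext_rel G) (wedge x y).
Definition lbrack0 x y : lext := term_class (@lext_rel G) (brack0 x y).

Definition chi_gen (s : lext_gen G) : G :=
  match s with Wedge x y => x ⋆ y | Bracket x y => [! x, y] end.

Lemma mla_eval_conj (X : Type) (f : X -> G) a b :
  mla_eval f (a ^> b)%T = mla_eval f a ^> mla_eval f b.
Proof. by []. Qed.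
Lemma mla_eval_comm (X : Type) (f : X -> G) a b :
  mla_eval f [! a, b]%T = [! mla_eval f a, mla_eval f b].
Proof. by []. Qed.

Lemma lcommg_star_star x y u v : [! x ⋆ y, u ⋆ v] = [! [! x, y], u ⋆ v].
Proof. by rewrite (lcommgE (x ⋆ y)) (lcommgE [! x, y]) star_act. Qed.

Lemma star_hall x y z :
  (x ⋆ y) * ((z ^> y) ⋆ (z ^> x)) =
  (((x * y) ^> x^-1) ⋆ (x ^> z)) * (x ⋆ z).
Proof.
transitivity ([! x, y] ⋆ z).
  by rewrite star_lcommg -starJ -starV /lcommg /lconjg !gsimp.
have -> : [! x, y] = x * (y ^> x^-1) by rewrite /lcommg /lconjg !gsimp.
by rewrite starMl lconjMg (starJ _ z).
Qed.

Lemma chi_rel a b : lext_rel a b -> mla_eval chi_gen a = mla_eval chi_gen b.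
Proof.
have cxx x : [! x, x] = 1 by rewrite /lcommg !gsimp.
case=> /=.
- exact: star1x.
- exact: starx1.
- exact: starxx.
- by move=> x; rewrite /lcommg !gsimp.
- by move=> x; rewrite /lcommg !gsimp.
- exact: cxx.
- exact: star_antisym.
- by move=> x y; rewrite -lcommgV mulVg.
- by move=> x y z; rewrite starMr starJ.
- by move=> x y z; rewrite /lcommg /lconjg !gsimp.
- by move=> x y z; rewrite starMl starJ.
- by move=> x y z; rewrite /lcommg /lconjg !gsimp.
- exact: lcommg_star_star.
- by move=> x y u v; rewrite star_lcommg; apply/esym/lcommg_star_star.
- move=> x y u v; rewrite !star_lcommg.
  rewrite -[LHS]lcommgV -[RHS]lcommgV; congr (_^-1).
  exact: lcommg_star_star.
- exact: star_hall.
- by move=> x y z; rewrite /lcommg /lconjg !gsimp.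
- by [].
- by [].
Qed.

Definition chi : lext -> G := pres_lift chi_gen.

Lemma chi_morphism : mul_lie_morphism chi.
Proof. exact/pres_lift_morphism/chi_rel. Qed.
Lemma chi_wedge x y : chi (lwedge x y) = x ⋆ y.
Proof. by rewrite /chi pres_liftE //; apply: chi_rel. Qed.
Lemma chi_brack0 x y : chi (lbrack0 x y) = [! x, y].
Proof. by rewrite /chi pres_liftE //; apply: chi_rel. Qed.

Lemma chi_unique (f : lext -> G) :
  mul_lie_morphism f -> (forall x y, f (lwedge x y) = x ⋆ y) ->
  (forall x y, f (lbrack0 x y) = [! x, y]) -> f =1 chi.
Proof.
move=> hf fw fb; have hc := chi_morphism.
elim/pres_ind=> [[x y|x y]||p q hp hq|p hp|p q hp hq].
- by rewrite fw chi_wedge.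
- by rewrite fb chi_brack0.
- by rewrite (mul_lie_morphism1 hf) (mul_lie_morphism1 hc).
- by rewrite hf.1 hc.1 hp hq.
- by rewrite (mul_lie_morphismV p hf) (mul_lie_morphismV p hc) hp.
- by rewrite hf.2 hc.2 hp hq.
Qed.

Definition schur_multiplier : mul_lie_sub lext := kernel chi_morphism.

Definition M0_gen (w : lext) : Prop :=
  exists x y, [/\ x ⋆ y = 1, [! x, y] = 1 & w = lwedge x y \/ w = lbrack0 x y].

(* The subgroup generated by M0_gen.  Its elements are central with trivial
   star (M0_central), so it is also the generated subalgebra and ideal. *)
Definition M0_pred : lext -> Prop := gen_subgroup M0_gen.

Lemma M0_sub_kernel w : M0_pred w -> schur_multiplier w.
Proof.
elim=> [_ [x [y [hs hc [->|->]]]]||p q _ hp _ hq|p _ hp].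
- by rewrite /= chi_wedge.
- by rewrite /= chi_brack0.
- exact: sub1.
- exact: subM.
- exact: subV.
Qed.

Lemma lext_relE a b :
  lext_rel a b -> term_class (@lext_rel G) a = term_class (@lext_rel G) b.
Proof. by move=> h; apply/term_classP/PRel. Qed.

Lemma lwedgeMr x y z :
  lwedge x (y * z) = lwedge x y * lwedge (y ^> x) (y ^> z).
Proof. by rewrite -term_classM; apply/lext_relE/LwMr. Qed.
Lemma lwedgeMl x y z :
  lwedge (x * y) z = lwedge (x ^> y) (x ^> z) * lwedge x z.
Proof. by rewrite -term_classM; apply/lext_relE/LwMl. Qed.
Lemma lbrack0Mr x y z :
  lbrack0 x (y * z) = lbrack0 x y * lbrack0 (y ^> x) (y ^> z).
Proof. by rewrite -term_classM; apply/lext_relE/LbMr. Qed.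
Lemma lbrack0Ml x y z :
  lbrack0 (x * y) z = lbrack0 (x ^> y) (x ^> z) * lbrack0 x z.
Proof. by rewrite -term_classM; apply/lext_relE/LbMl. Qed.
Lemma lcommg_wedge_wedge x y u v :
  [! lwedge x y, lwedge u v] = [! lbrack0 x y, lwedge u v].
Proof. by rewrite -!term_classR; apply/lext_relE/Lcomm_w_w. Qed.
Lemma lcommg_brack0_wedge x y u v :
  [! lbrack0 x y, lwedge u v] = lbrack0 x y ⋆ lwedge u v.
Proof.
by rewrite -term_classR -term_classS; apply/lext_relE/Lcomm_b_w.
Qed.
Lemma star_brack0_wedge x y u v :
  lbrack0 x y ⋆ lwedge u v = lbrack0 x y ⋆ lbrack0 u v.
Proof. by rewrite -!term_classS; apply/lext_relE/Lstar_b_w. Qed.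
Lemma star_wedge_wedge x y u v :
  lwedge x y ⋆ lwedge u v = lwedge (x ⋆ y) (u ⋆ v).
Proof. by rewrite -term_classS; apply/lext_relE/Lstar_w_w. Qed.
Lemma lwedge1x x : lwedge 1 x = 1.
Proof. exact/lext_relE/Lw1x. Qed.

Lemma biadditive_commute (F : G -> G -> lext) :
  (forall x y z, F x (y * z) = F x y * F (y ^> x) (y ^> z)) ->
  (forall x y z, F (x * y) z = F (x ^> y) (x ^> z) * F x z) ->
  forall x y u v, x * y = y * x -> F x y * F u v = F u v * F x y.
Proof.
move=> Fr Fl x y u v xy.
have key s t : F (x ^> (y ^> s)) (x ^> (y ^> t)) * F x y =
               F x y * F (y ^> (x ^> s)) (y ^> (x ^> t)).
  have cj a b c : (a ^> b) ^> (a ^> c) = a ^> (b ^> c).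
    by rewrite /lconjg !gsimp.
  have e1 := Fl x s (y * t).
  have e2 := Fr (x * s) y t.
  rewrite (lconjgM x y t) (Fr _ (x ^> y)) (Fr x) !cj in e1.
  rewrite (Fl x s y) (lconjgM y x s) (Fl (y ^> x)) !cj e1 in e2.
  move: e2; rewrite !mulgA => /mulIg.
  by rewrite -!mulgA => /mulgI.
have := key ((x * y)^-1 ^> u) ((x * y)^-1 ^> v).
have exy c : x ^> (y ^> ((x * y)^-1 ^> c)) = c by rewrite /lconjg !gsimp.
have eyx c : y ^> (x ^> ((x * y)^-1 ^> c)) = c.
  by rewrite xy /lconjg !gsimp.
by rewrite !exy !eyx => ->.
Qed.

Lemma lext_center w :
  (forall x y, w * lwedge x y = lwedge x y * w /\ w ⋆ lwedge x y = 1) ->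
  (forall x y, w * lbrack0 x y = lbrack0 x y * w /\ w ⋆ lbrack0 x y = 1) ->
  lie_center w.
Proof.
move=> hw hb.
suff H p : w ^> p = p /\ w ⋆ p = 1.
  by move=> p; have [h1 h2] := H p; split=> //; apply/lcommg_eq_lconjg.
have conjE q : w * q = q * w -> w ^> q = q.
  by move=> e; rewrite /lconjg e !gsimp.
have wJ q : w ^> q = q -> q ^> w = w.
  by move=> /lcommg_eq_lconjg/lcommg1P e; rewrite /lconjg -e !gsimp.
elim/pres_ind: p => [[x y|x y]||p q [hp sp] [hq sq]|p [hp sp]|p q [hp sp] [hq sq]].
- by have [h1 h2] := hw x y; split=> //; apply: conjE.
- by have [h1 h2] := hb x y; split=> //; apply: conjE.
- by rewrite lconjg1 starx1.
- by rewrite lconjgM hp hq starMr sp sq lconjg1 mulg1.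
- split; first by rewrite lconjgV hp.
  by have := starMr w p^-1 p; rewrite mulVg starx1 sp lconjg1 mulg1.
- split; first by rewrite starJ hp hq.
  have := star_jacobi p q w.
  rewrite (wJ q hq) hp sp -(starV w q) sq invg1 !star1x !mulg1.
  by move=> h; rewrite -starV h invg1.
Qed.

Lemma M0_gen_central w : M0_gen w -> lie_center w.
Proof.
case=> x [y [hs hc hw]].
have xy : x * y = y * x by apply/lcommg1P.
have ww u v : [! lwedge x y, lwedge u v] = 1.
  by apply/lcommg1P/(biadditive_commute lwedgeMr lwedgeMl).
have bb u v : [! lbrack0 x y, lbrack0 u v] = 1.
  by apply/lcommg1P/(biadditive_commute lbrack0Mr lbrack0Ml).
case: hw => ->; apply: lext_center => u v; split.
- by apply/lcommg1P.
- by rewrite star_wedge_wedge hs lwedge1x.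
- apply/lcommg1P; rewrite -lcommgV -lcommg_wedge_wedge.
  by rewrite -[X in X^-1]lcommgV ww !invg1.
- rewrite -starV -lcommg_brack0_wedge -lcommg_wedge_wedge.
  by rewrite -[X in X^-1]lcommgV ww !invg1.
- by apply/lcommg1P; rewrite -lcommg_wedge_wedge.
- by rewrite -lcommg_brack0_wedge -lcommg_wedge_wedge.
- by apply/lcommg1P.
- by rewrite -star_brack0_wedge -lcommg_brack0_wedge -lcommg_wedge_wedge.
Qed.

Lemma M0_central w : M0_pred w -> lie_center w.
Proof.
elim=> [p|||]; [exact: M0_gen_central|exact: lie_center1| |].
- by move=> p q _ hp _ hq; apply: lie_centerM.
- by move=> p _ hp; apply: lie_centerV.
Qed.

Definition schur_alg : mulLieType := sub_type schur_multiplier.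

Definition M0_in_schur (w : schur_alg) : Prop := M0_pred (sub_val w).

Fact M0_1 : M0_in_schur 1.
Proof. by rewrite /M0_in_schur sub_val1; apply: Gen1. Qed.
Fact M0_M p q : M0_in_schur p -> M0_in_schur q -> M0_in_schur (p * q).
Proof. by move=> hp hq; rewrite /M0_in_schur sub_valM; apply: GenM. Qed.
Fact M0_V p : M0_in_schur p -> M0_in_schur p^-1.
Proof. by move=> hp; rewrite /M0_in_schur sub_valV; apply: GenV. Qed.
Fact M0_J r p : M0_in_schur p -> M0_in_schur (r ^> p).
Proof.
by move=> hp; rewrite /M0_in_schur sub_valJ lie_centerJ //; apply: M0_central.
Qed.
Fact M0_Sl r p : M0_in_schur p -> M0_in_schur (p ⋆ r).
Proof.
move=> hp; rewrite /M0_in_schur sub_starE.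
by rewrite (M0_central hp (sub_val r)).2; apply: Gen1.
Qed.
Fact M0_Sr r p : M0_in_schur p -> M0_in_schur (r ⋆ p).
Proof. by move=> hp; rewrite -starV; apply/M0_V/M0_Sl. Qed.

Definition M0_ideal : mul_lie_ideal schur_alg :=
  MulLieIdeal M0_1 M0_M M0_V M0_J M0_Sr M0_Sl.

Definition B0 : mulLieType := quo_type M0_ideal.

End LieExteriorSquare.

(* Main.v *)
(** Modulo M0(G), the classes of x ∧ y and [x, y]_0 depend only on x and y
    modulo the centre Z(G).  An isoclinism (λ, μ) therefore transports them, by
    lifting λ arbitrarily to representatives, and defines mutually inverse
    homomorphisms between the quotients (G_i ∧^L G_i) / M0(G_i), in which
    B0(G_i) embeds as the kernel of the map induced by χ.  The existence of μ is
    what makes these maps kill M0 and preserve the kernel of χ. *)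

#[warnings="-notation-overridden"]
From mathcomp Require Import all_boot.
From mathcomp Require Import boolp.
Require Import Defs.

Set Implicit Arguments.
Unset Strict Implicit.
Unset Printing Implicit Defensive.

Import Algebra.
Local Open Scope group_scope.

(** * Inverting and restricting isomorphisms; central elements *)

Lemma mul_lie_iso_inv (G H : mulLieType) (f : G -> H) :
  mul_lie_iso f -> exists2 g, mul_lie_iso g & cancel f g /\ cancel g f.
Proof.
move=> [[fM fS] [g fK gK]]; exists g => //.
split; last by exists f.
split=> x y; apply: (can_inj fK).
  by rewrite fM !gK.
by rewrite fS !gK.
Qed.

(** The embeddings identify [A] and [B] with subalgebras that [h] and [k] exchange. Choice picks the
    preimages; injectivity of [i] and [j] then transfers the morphism laws to [f] and makes [f] and
    [g] mutually inverse. *)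
Lemma isomorphic_preim (A B P Q : mulLieType) (i : A -> P) (j : B -> Q)
    (h : P -> Q) (k : Q -> P) :
  mul_lie_morphism i -> injective i -> mul_lie_morphism j -> injective j ->
  mul_lie_morphism h -> cancel h k -> cancel k h ->
  (forall a, exists b, j b = h (i a)) -> (forall b, exists a, i a = k (j b)) ->
  isomorphic A B.
Proof.
move=> [iM iS] i_inj [jM jS] j_inj [hM hS] hK kK /choice[f fE] /choice[g gE].
exists f; split.
  split=> a b; apply: j_inj; first by rewrite jM !fE iM hM.
  by rewrite jS !fE iS hS.
exists g => a.
  by apply: i_inj; rewrite gE fE hK.
by apply: j_inj; rewrite fE gE kK.
Qed.

Lemma to_quo_repr (G : mulLieType) (I : mul_lie_ideal G) (q : quo_type I) :
  to_quo I (repr q) = q.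
Proof. exact: reprK. Qed.

Lemma lie_center_conjl (G : mulLieType) (a x : G) : lie_center a -> a ^> x = x.
Proof. by move=> /(_ x)[/lcommg_eq_lconjg]. Qed.

Lemma lie_center_eq1r (G : mulLieType) (a x : G) :
  lie_center a -> x ⋆ a = 1 /\ [! x, a] = 1.
Proof.
by move=> /(_ x)[hc hs]; rewrite -starV hs -lcommgV hc invg1.
Qed.

(** * Maps induced on a quotient *)

Section QuotientLift.
Variables (G H : mulLieType) (I : mul_lie_ideal G) (f : G -> H).
Hypotheses (hf : mul_lie_morphism f) (fI : forall x, I x -> f x = 1).

Definition quo_lift (q : quo_type I) : H := f (repr q).

(** The chosen representative of the class differs from [x] by a factor in [I], which [f] kills. *)
Lemma quo_liftE x : quo_lift (to_quo I x) = f x.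
Proof.
have := fI (quo_repr I x); rewrite hf.1 mul_lie_morphismV // => e.
by apply: (mulIg (f x)^-1); rewrite e mulgV.
Qed.

Lemma quo_lift_morphism : mul_lie_morphism quo_lift.
Proof.
split; elim/quoW=> x; elim/quoW=> y.
  by rewrite -to_quoM !quo_liftE hf.1.
by rewrite -to_quoS !quo_liftE hf.2.
Qed.

End QuotientLift.

(** * The exterior square modulo M0 *)

Section LextModM0.
Variable G : mulLieType.
Implicit Types (x y z : G) (w : lext G).

Fact M0_lextJ (g w : lext G) : M0_pred w -> M0_pred (g ^> w).
Proof. by move=> hw; rewrite lie_centerJ //; apply: M0_central. Qed.
Fact M0_lextSl (g w : lext G) : M0_pred w -> M0_pred (w ⋆ g).
Proof. by move=> hw; rewrite (M0_central hw g).2; apply: Gen1. Qed.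
Fact M0_lextSr (g w : lext G) : M0_pred w -> M0_pred (g ⋆ w).
Proof. by move=> hw; rewrite -starV; apply/GenV/M0_lextSl. Qed.

(** Dividing the whole square, and not only the Schur multiplier, keeps the generators on which maps
    can be defined. *)
Definition M0_lext : mul_lie_ideal (lext G) :=
  MulLieIdeal (Gen1 _) (@GenM _ _) (@GenV _ _) M0_lextJ M0_lextSr M0_lextSl.

Definition lext_mod : mulLieType := quo_type M0_lext.
Definition mwedge x y : lext_mod := to_quo M0_lext (lwedge x y).
Definition mbrack x y : lext_mod := to_quo M0_lext (lbrack0 x y).

Definition lext_mod_gen (g : lext_gen G) : lext_mod :=
  match g with Wedge x y => mwedge x y | Bracket x y => mbrack x y end.

(** Turns each defining relation into an identity between [mwedge] and [mbrack]; [transport_rel]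
    uses these identities in the target algebra. *)
Lemma lext_mod_rel a b :
  lext_rel a b -> mla_eval lext_mod_gen a = mla_eval lext_mod_gen b.
Proof.
have evalE t : mla_eval lext_mod_gen t = to_quo M0_lext (term_class _ t).
  elim: t => [[x y|x y]||p hp q hq|p hp|p hp q hq] //=.
  - by rewrite hp hq -to_quoM -term_classM.
  - by rewrite hp -to_quoV -term_classV.
  - by rewrite hp hq -to_quoS -term_classS.
by move=> /lext_relE h; rewrite !evalE h.
Qed.

Lemma to_quo_M0 w : M0_pred w -> to_quo M0_lext w = 1.
Proof. by move=> hw; rewrite -to_quo1; apply/to_quoP; rewrite invg1 mulg1. Qed.

Lemma mwedge_eq1 x y : x ⋆ y = 1 -> [! x, y] = 1 -> mwedge x y = 1.
Proof.
by move=> hs hc; apply/to_quo_M0/GenMem; exists x, y; split=> //; left.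
Qed.

Lemma mbrack_eq1 x y : x ⋆ y = 1 -> [! x, y] = 1 -> mbrack x y = 1.
Proof.
by move=> hs hc; apply/to_quo_M0/GenMem; exists x, y; split=> //; right.
Qed.

(** Write [x] as [a * x'] with [a] central. Conjugation by [a] is trivial, so expansion leaves
    [mwedge x' y] times [mwedge a y], and the latter is 1 because [a ⋆ y] and [[! a, y]] are. The
    second entry is treated alike. *)
Lemma mwedge_center x x' y y' :
  center_class x = center_class x' -> center_class y = center_class y' ->
  mwedge x y = mwedge x' y'.
Proof.
move=> /to_quoP hx /to_quoP hy.
transitivity (mwedge x' y).
  rewrite -[x](mulgVK x') /mwedge lwedgeMl !(lie_center_conjl _ hx) to_quoM.
  have [hc hs] := hx y.
  by rewrite -/(mwedge _ y) [X in _ * X]mwedge_eq1 ?mulg1.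
rewrite -[y](mulgVK y') /mwedge lwedgeMr !(lie_center_conjl _ hy) to_quoM.
have [hs hc] := lie_center_eq1r x' hy.
by rewrite -/(mwedge x' _) [X in X * _]mwedge_eq1 ?mul1g.
Qed.

Lemma mbrack_center x x' y y' :
  center_class x = center_class x' -> center_class y = center_class y' ->
  mbrack x y = mbrack x' y'.
Proof.
move=> /to_quoP hx /to_quoP hy.
transitivity (mbrack x' y).
  rewrite -[x](mulgVK x') /mbrack lbrack0Ml !(lie_center_conjl _ hx) to_quoM.
  have [hc hs] := hx y.
  by rewrite -/(mbrack _ y) [X in _ * X]mbrack_eq1 ?mulg1.
rewrite -[y](mulgVK y') /mbrack lbrack0Mr !(lie_center_conjl _ hy) to_quoM.
have [hs hc] := lie_center_eq1r x' hy.
by rewrite -/(mbrack x' _) [X in X * _]mbrack_eq1 ?mul1g.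
Qed.

Lemma lext_mod_ind (P : lext_mod -> Prop) :
  (forall x y, P (mwedge x y)) -> (forall x y, P (mbrack x y)) -> P 1 ->
  (forall p q, P p -> P q -> P (p * q)) -> (forall p, P p -> P p^-1) ->
  (forall p q, P p -> P q -> P (p ⋆ q)) -> forall p, P p.
Proof.
move=> Pw Pb P1 PM PV PS; elim/quoW.
elim/pres_ind=> [[x y|x y]||p q hp hq|p hp|p q hp hq] //.
- exact: Pw.
- exact: Pb.
- by rewrite to_quoM; apply: PM.
- by rewrite to_quoV; apply: PV.
- by rewrite to_quoS; apply: PS.
Qed.

(** Serves for composites of two transports, where checking generators suffices. *)
Lemma lext_mod_endo_id (f : lext_mod -> lext_mod) :
  mul_lie_morphism f -> (forall x y, f (mwedge x y) = mwedge x y) ->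
  (forall x y, f (mbrack x y) = mbrack x y) -> f =1 id.
Proof.
move=> hf fw fb; elim/lext_mod_ind=> //= [|p q hp hq|p hp|p q hp hq].
- exact: mul_lie_morphism1.
- by rewrite hf.1 hp hq.
- by rewrite mul_lie_morphismV // hp.
- by rewrite hf.2 hp hq.
Qed.

Definition chi_mod : lext_mod -> G := quo_lift (I := M0_lext) (@chi G).

Lemma chi_modE w : chi_mod (to_quo M0_lext w) = chi w.
Proof. by apply: quo_liftE; [exact: chi_morphism|exact: M0_sub_kernel]. Qed.

Lemma chi_mod_morphism : mul_lie_morphism chi_mod.
Proof.
by apply: quo_lift_morphism; [exact: chi_morphism|exact: M0_sub_kernel].
Qed.

Lemma chi_mod_wedge x y : chi_mod (mwedge x y) = x ⋆ y.
Proof. by rewrite chi_modE chi_wedge. Qed.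
Lemma chi_mod_brack x y : chi_mod (mbrack x y) = [! x, y].
Proof. by rewrite chi_modE chi_brack0. Qed.

Definition schur_mod (u : schur_alg G) : lext_mod := to_quo M0_lext (sub_val u).

Lemma schur_mod_morphism : mul_lie_morphism schur_mod.
Proof.
split=> u v; first by rewrite /schur_mod sub_valM to_quoM.
by rewrite /schur_mod sub_starE to_quoS.
Qed.

Definition B0_incl : B0 G -> lext_mod := quo_lift (I := M0_ideal G) schur_mod.

Let schur_mod_M0 u : M0_ideal G u -> schur_mod u = 1.
Proof. exact: to_quo_M0. Qed.

Lemma B0_inclE u : B0_incl (to_quo (M0_ideal G) u) = schur_mod u.
Proof. exact: (quo_liftE schur_mod_morphism schur_mod_M0). Qed.

Lemma B0_incl_morphism : mul_lie_morphism B0_incl.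
Proof. exact: (quo_lift_morphism schur_mod_morphism schur_mod_M0). Qed.

(** [M0_ideal] is the trace of [M0_lext] on the Schur multiplier, so both give the same congruence
    there. *)
Lemma B0_incl_inj : injective B0_incl.
Proof.
elim/quoW=> u; elim/quoW=> v; rewrite !B0_inclE => /to_quoP h.
by apply/to_quoP; rewrite /= /M0_in_schur sub_valM sub_valV.
Qed.

(** Since M0 lies in the kernel of [chi], a class is killed by [chi_mod] exactly when its
    representatives lie in the Schur multiplier. *)
Lemma B0_incl_imageP q : chi_mod q = 1 <-> exists p, B0_incl p = q.
Proof.
split=> [|[p <-]]; last first.
  by elim/quoW: p => u; rewrite B0_inclE chi_modE; apply: (sub_valP u).
elim/quoW: q => w; rewrite chi_modE => hw.
by exists (to_quo (M0_ideal G) (to_sub (S := schur_multiplier G) hw));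
  rewrite B0_inclE.
Qed.

End LextModM0.

(** * Classes modulo the centre and transport along maps between them *)

Section CenterClass.
Variable G : mulLieType.
Implicit Types x y : G.

Lemma center_class1 : center_class (1 : G) = 1.
Proof. exact: to_quo1. Qed.
Lemma center_classM x y :
  center_class (x * y) = center_class x * center_class y.
Proof. exact: to_quoM. Qed.
Lemma center_classV x : center_class x^-1 = (center_class x)^-1.
Proof. exact: to_quoV. Qed.
Lemma center_classS x y :
  center_class (x ⋆ y) = center_class x ⋆ center_class y.
Proof. exact: to_quoS. Qed.
Lemma center_class_surj (p : center_quo G) : exists x, p = center_class x.
Proof. by exists (repr p); rewrite /center_class to_quo_repr. Qed.

End CenterClass.

(** Quantifying over all representatives [x'] and [y'] frees the condition from any choice of lift,
    so transports compose directly. *)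
Definition transports (G H : mulLieType) (lam : center_quo G -> center_quo H)
    (f : lext_mod G -> lext_mod H) : Prop :=
  forall x y x' y',
    lam (center_class x) = center_class x' ->
    lam (center_class y) = center_class y' ->
    f (mwedge x y) = mwedge x' y' /\ f (mbrack x y) = mbrack x' y'.

Lemma transportsK (G H : mulLieType) (lam : center_quo G -> center_quo H)
    (lam' : center_quo H -> center_quo G) (f : lext_mod G -> lext_mod H)
    (g : lext_mod H -> lext_mod G) :
  cancel lam lam' -> mul_lie_morphism f -> mul_lie_morphism g ->
  transports lam f -> transports lam' g -> cancel f g.
Proof.
move=> lamK [fM fS] [gM gS] fE gE.
have gfE x y :
    g (f (mwedge x y)) = mwedge x y /\ g (f (mbrack x y)) = mbrack x y.
  have [x' xE] := center_class_surj (lam (center_class x)).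
  have [y' yE] := center_class_surj (lam (center_class y)).
  have [-> ->] := fE _ _ _ _ xE yE.
  (* By [lamK], [x] and [y] represent the images under [lam'] of the classes of [x'] and [y']. *)
  by apply: gE; rewrite -?xE -?yE lamK.
apply: lext_mod_endo_id => [|x y|x y]; try by case: (gfE x y).
by split=> p q; rewrite (fM, fS) (gM, gS).
Qed.

(** * Construction of the transport from [lam] and [mu] *)

Section Transport.
Variables (G H : mulLieType).
Variables (lam : center_quo G -> center_quo H).
Variables (mu : derived_alg G -> derived_alg H).
Hypotheses (lamP : mul_lie_morphism lam) (muP : mul_lie_morphism mu).
Hypothesis mu_lam : forall (a b : G) (a' b' : H),
  lam (center_class a) = center_class a' ->
  lam (center_class b) = center_class b' ->
  mu (der_comm a b) = der_comm a' b' /\ mu (der_star a b) = der_star a' b'.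

(** A set-theoretic lift of [lam]. It respects the operations modulo the centre, which suffices by
    [mwedge_center] and [mbrack_center]. *)
Let s (x : G) : H := repr (lam (center_class x)).

Let sE x : center_class (s x) = lam (center_class x).
Proof. exact: to_quo_repr. Qed.

Let s1 : center_class (s 1) = center_class 1.
Proof. by rewrite sE center_class1 (mul_lie_morphism1 lamP). Qed.
Let sM x y : center_class (s (x * y)) = center_class (s x * s y).
Proof. by rewrite sE !center_classM lamP.1 !sE. Qed.
Let sV x : center_class (s x^-1) = center_class (s x)^-1.
Proof. by rewrite sE !center_classV mul_lie_morphismV // sE. Qed.
Let sS x y : center_class (s (x ⋆ y)) = center_class (s x ⋆ s y).
Proof. by rewrite sE !center_classS lamP.2 !sE. Qed.
Let sJ x y : center_class (s (x ^> y)) = center_class (s x ^> s y).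
Proof. by rewrite sM !center_classM sM sV !center_classM. Qed.
Let sR x y : center_class (s [! x, y]) = center_class [! s x, s y].
Proof. by rewrite !lcommgE sM !center_classM sJ sV !center_classM. Qed.
Let sHall x y :
  center_class (s ((x * y) ^> x^-1)) = center_class ((s x * s y) ^> (s x)^-1).
Proof.
rewrite sJ !center_classM !center_classV sM sV.
by rewrite !center_classM !center_classV.
Qed.

Let transport_gen (g : lext_gen G) : lext_mod H :=
  match g with
  | Wedge x y => mwedge (s x) (s y)
  | Bracket x y => mbrack (s x) (s y)
  end.

(** The lift of a compound entry has the same class as the same expression in the lifts of its
    variables. After this replacement each relation is an instance of itself in [H]. *)
Let transport_rel a b :
  lext_rel a b -> mla_eval transport_gen a = mla_eval transport_gen b.
Proof.
pose rel := @lext_mod_rel H.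
(* These four replace one entry by another of the same class and keep the other entry through
   [erefl]. *)
pose wl x x' y h := @mwedge_center H x x' y y h erefl.
pose wr x y y' h := @mwedge_center H x x y y' erefl h.
pose bl x x' y h := @mbrack_center H x x' y y h erefl.
pose br x y y' h := @mbrack_center H x x y y' erefl h.
case=> /=.
- by move=> x; rewrite (wl _ _ _ s1); apply: (rel _ _ (Lw1x _)).
- by move=> x; rewrite (wr _ _ _ s1); apply: (rel _ _ (Lwx1 _)).
- by move=> x; apply: (rel _ _ (Lwxx _)).
- by move=> x; rewrite (bl _ _ _ s1); apply: (rel _ _ (Lb1x _)).
- by move=> x; rewrite (br _ _ _ s1); apply: (rel _ _ (Lbx1 _)).
- by move=> x; apply: (rel _ _ (Lbxx _)).
- by move=> x y; apply: (rel _ _ (Lw_antisym _ _)).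
- by move=> x y; apply: (rel _ _ (Lb_antisym _ _)).
- move=> x y z; rewrite (wr _ _ _ (sM _ _)) (mwedge_center (sJ _ _) (sJ _ _)).
  exact: (rel _ _ (LwMr _ _ _)).
- move=> x y z; rewrite (br _ _ _ (sM _ _)) (mbrack_center (sJ _ _) (sJ _ _)).
  exact: (rel _ _ (LbMr _ _ _)).
- move=> x y z; rewrite (wl _ _ _ (sM _ _)) (mwedge_center (sJ _ _) (sJ _ _)).
  exact: (rel _ _ (LwMl _ _ _)).
- move=> x y z; rewrite (bl _ _ _ (sM _ _)) (mbrack_center (sJ _ _) (sJ _ _)).
  exact: (rel _ _ (LbMl _ _ _)).
- by move=> x y u v; apply: (rel _ _ (Lcomm_w_w _ _ _ _)).
- by move=> x y u v; apply: (rel _ _ (Lcomm_b_w _ _ _ _)).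
- by move=> x y u v; apply: (rel _ _ (Lstar_b_w _ _ _ _)).
- move=> x y z; rewrite (mwedge_center (sJ z y) (sJ z x)).
  rewrite (mwedge_center (sHall x y) (sJ x z)).
  exact: (rel _ _ (Lw_hall _ _ _)).
- move=> x y z; rewrite (mbrack_center (sJ z y) (sJ z x)).
  rewrite (mbrack_center (sHall x y) (sJ x z)).
  exact: (rel _ _ (Lb_hall _ _ _)).
- move=> x y u v; rewrite (mbrack_center (sR _ _) (sR _ _)).
  exact: (rel _ _ (Lcomm_b_b _ _ _ _)).
- move=> x y u v; rewrite (mwedge_center (sS _ _) (sS _ _)).
  exact: (rel _ _ (Lstar_w_w _ _ _ _)).
Qed.

Let transport_lext : lext G -> lext_mod H := pres_lift transport_gen.

Let transport_lext_morphism : mul_lie_morphism transport_lext.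
Proof. exact/pres_lift_morphism/transport_rel. Qed.
Let transport_lwedge x y : transport_lext (lwedge x y) = mwedge (s x) (s y).
Proof. exact: (pres_liftE transport_rel). Qed.
Let transport_lbrack0 x y : transport_lext (lbrack0 x y) = mbrack (s x) (s y).
Proof. exact: (pres_liftE transport_rel). Qed.

Let mu_s x y :
  sub_val (mu (der_star x y)) = s x ⋆ s y /\
  sub_val (mu (der_comm x y)) = [! s x, s y].
Proof. by have [-> ->] := mu_lam (esym (sE x)) (esym (sE y)). Qed.

Let mu_eq1 (d : derived_alg G) : sub_val d = 1 -> sub_val (mu d) = 1.
Proof.
move=> d1; have -> : d = 1 by apply: sub_val_inj.
by rewrite (mul_lie_morphism1 muP).
Qed.

(** If [x ⋆ y] and [[! x, y]] are 1, then [mu] sends both to 1; by [mu_s] the star and commutator of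
    the lifts are 1 as well, so the transported generator vanishes. *)
Let transport_M0 w : M0_pred w -> transport_lext w = 1.
Proof.
have [fM _] := transport_lext_morphism.
elim=> [v [x [y [hs hc hv]]]||p q _ hp _ hq|p _ hp].
- have [ms mc] := mu_s x y.
  have hs' : s x ⋆ s y = 1 by rewrite -ms mu_eq1.
  have hc' : [! s x, s y] = 1 by rewrite -mc mu_eq1.
  case: hv => ->; first by rewrite transport_lwedge mwedge_eq1.
  by rewrite transport_lbrack0 mbrack_eq1.
- exact: mul_lie_morphism1.
- by rewrite fM hp hq mulg1.
- by rewrite mul_lie_morphismV // hp invg1.
Qed.

(** Both ways round the square are morphisms and agree on generators by [mu_s]. The witness [d]
    packages [chi w] as an element of the derived algebra, so one induction yields membership and
    commutation together. *)
Let chi_transport w :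
  exists2 d : derived_alg G,
    sub_val d = chi w & sub_val (mu d) = chi_mod (transport_lext w).
Proof.
have hc := chi_morphism G; have hm := chi_mod_morphism H.
have hf := transport_lext_morphism.
elim/pres_ind: w => [[x y|x y]||p q [d dE mE] [e eE nE]|p [d dE mE]|
                     p q [d dE mE] [e eE nE]].
- exists (der_star x y); first by rewrite chi_wedge.
  by rewrite transport_lwedge chi_mod_wedge (mu_s x y).1.
- exists (der_comm x y); first by rewrite chi_brack0.
  by rewrite transport_lbrack0 chi_mod_brack (mu_s x y).2.
- exists 1; first by rewrite (mul_lie_morphism1 hc).
  by rewrite (mul_lie_morphism1 hf) (mul_lie_morphism1 hm) mu_eq1.
- by exists (d * e); rewrite ?muP.1 sub_valM ?hf.1 ?hc.1 ?hm.1 ?dE ?eE ?mE ?nE.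
- exists d^-1; first by rewrite sub_valV dE (mul_lie_morphismV _ hc).
  rewrite (mul_lie_morphismV _ muP) sub_valV mE.
  by rewrite (mul_lie_morphismV _ hf) (mul_lie_morphismV _ hm).
- exists (d ⋆ e); first by rewrite sub_starE hc.2 dE eE.
  by rewrite muP.2 sub_starE hf.2 hm.2 mE nE.
Qed.

Lemma lext_mod_transport :
  exists f : lext_mod G -> lext_mod H,
  [/\ mul_lie_morphism f, transports lam f &
      forall q, chi_mod q = 1 -> chi_mod (f q) = 1].
Proof.
have fE := quo_liftE (I := M0_lext G) transport_lext_morphism transport_M0.
exists (quo_lift (I := M0_lext G) transport_lext); split.
- exact: (quo_lift_morphism (I := M0_lext G) transport_lext_morphism
           transport_M0).
- move=> x y x' y'; rewrite -!sE => hx hy.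
  rewrite !fE transport_lwedge transport_lbrack0.
  by rewrite (mwedge_center hx hy) (mbrack_center hx hy).
- elim/quoW=> w; rewrite chi_modE fE => hw.
  (* Here [d] has value [chi w], which is 1, so [mu] sends it to 1. *)
  by have [d dE <-] := chi_transport w; apply: mu_eq1; rewrite dE.
Qed.

End Transport.

Theorem theorem3p15 (G1 G2 : mulLieType) :
  isoclinic G1 G2 -> isomorphic (B0 G1) (B0 G2).
Proof.
move=> [lam [mu [lam_iso mu_iso mu_lam]]].
have [lam' lam'_iso [lamK lam'K]] := mul_lie_iso_inv lam_iso.
have [mu' mu'_iso [muK mu'K]] := mul_lie_iso_inv mu_iso.
(* The inverse pair is compatible too: apply [mu_lam] with the roles exchanged and cancel [mu].
   Transports thus exist in both directions. *)
have mu'_lam' a b a' b' :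
    lam' (center_class a) = center_class a' ->
    lam' (center_class b) = center_class b' ->
    mu' (der_comm a b) = der_comm a' b' /\ mu' (der_star a b) = der_star a' b'.
  move=> ha hb; have [] := mu_lam a' b' a b.
  - by rewrite -ha lam'K.
  - by rewrite -hb lam'K.
  - by move=> <- <-; rewrite !muK.
have [f [fP fE f_chi]] := lext_mod_transport lam_iso.1 mu_iso.1 mu_lam.
have [g [gP gE g_chi]] := lext_mod_transport lam'_iso.1 mu'_iso.1 mu'_lam'.
have fK := transportsK lamK fP gP fE gE.
have gK := transportsK lam'K gP fP gE fE.
(* [f] and [g] preserve the kernel of [chi_mod], which is the image of [B0_incl], so they restrict
   to it. *)
apply: (isomorphic_preim (B0_incl_morphism G1) (@B0_incl_inj G1)
         (B0_incl_morphism G2) (@B0_incl_inj G2) fP fK gK) => p.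
  by apply/B0_incl_imageP/f_chi/B0_incl_imageP; exists p.
by apply/B0_incl_imageP/g_chi/B0_incl_imageP; exists p.
Qed.
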